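(* For any graphs $G$ and $H$ with no isolated vertex, $$\max\{\rho(G)\gamma_{R}(H), \rho(H)\gamma_{R}(G)\}\leq \gamma_{R}(G\times H)\leq \min\{2\gamma(G)\gamma_{tR}(H), 2\gamma(H)\gamma_{tR}(G)\}.$$
   Context: All graphs are finite and simple; $N(v)$ is the open and $N[v]=N(v)\cup\{v\}$ the closed neighborhood of $v$. The direct product $G\times H$ has vertex set $V(G)\times V(H)$, with $(u,v)$ adjacent to $(u',v')$ iff $uu'\in E(G)$ and $vv'\in E(H)$. A set $S\subseteq V(G)$ is dominating if every vertex is in $S$ or adjacent to a vertex of $S$; $\gamma(G)$ is the minimum size of a dominating set. A packing is a set $A\subseteq V(G)$ such that $N[x]\cap N[y]=\emptyset$ for all distinct $x,y\in A$; $\rho(G)$ is the maximum size of a packing. For $f:V(G)\to\{0,1,2\}$ write $V_i=\{v: f(v)=i\}$ and $\omega(f)=|V_1|+2|V_2|$. $f$ is a Roman dominating function (RDF) if every vertex in $V_0$ has a neighbor in $V_2$; $\gamma_R(G)$ is the minimum weight of an RDF. An RDF is a total Roman dominating function (TRDF) if the subgraph induced by $V_1\cup V_2$ has no isolated vertices; $\gamma_{tR}(G)$ is the minimum weight of a TRDF. *)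

(* Defs.v *)
From mathcomp Require Import all_boot.

Set Implicit Arguments.
Unset Strict Implicit.
Unset Printing Implicit Defensive.

Record sgraph := SGraph {
  vertex :> finType;
  adj : rel vertex;
  adj_sym : symmetric adj;
  adj_irrefl : irreflexive adj }.

Definition opn (G : sgraph) (v : G) : {set G} := [set w | adj v w].
Definition cln (G : sgraph) (v : G) : {set G} := v |: opn v.

Definition isolated (G : sgraph) (v : G) : bool := opn v == set0.
Definition no_isolated (G : sgraph) : bool := [forall v : G, ~~ isolated v].

Section DirectProduct.
Variables G H : sgraph.

Definition dprod_adj : rel (G * H) :=
  fun p q => adj p.1 q.1 && adj p.2 q.2.

Lemma dprod_adj_sym : symmetric dprod_adj.
Proof. by move=> p q; rewrite /dprod_adj !(adj_sym p.1) (adj_sym p.2). Qed.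

Lemma dprod_adj_irrefl : irreflexive dprod_adj.
Proof. by move=> p; rewrite /dprod_adj adj_irrefl. Qed.

Definition dprod_graph : sgraph := SGraph dprod_adj_sym dprod_adj_irrefl.
End DirectProduct.

Section Induced.
Variables (G : sgraph) (S : {set G}).

Definition induced_adj : rel {x : G | x \in S} :=
  fun x y => adj (val x) (val y).

Lemma induced_adj_sym : symmetric induced_adj.
Proof. by move=> x y; rewrite /induced_adj adj_sym. Qed.

Lemma induced_adj_irrefl : irreflexive induced_adj.
Proof. by move=> x; rewrite /induced_adj adj_irrefl. Qed.

Definition induced : sgraph := SGraph induced_adj_sym induced_adj_irrefl.
End Induced.

Section Domination.
Variable G : sgraph.
Implicit Types (D A : {set G}) (f : {ffun G -> 'I_3}).

Definition dominating D : bool :=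
  [forall v : G, (v \in D) || [exists u in D, adj v u]].

Definition packing A : bool :=
  [forall x in A, forall y in A, (x != y) ==> (cln x :&: cln y == set0)].

Definition V_ f (i : nat) : {set G} := [set v | f v == i :> nat].

Definition weight f : nat := #|V_ f 1| + 2 * #|V_ f 2|.

Definition RDF f : bool :=
  [forall v in V_ f 0, exists w in V_ f 2, adj v w].

Definition TRDF f : bool :=
  RDF f && no_isolated (induced (V_ f 1 :|: V_ f 2)).

Definition const2 : {ffun G -> 'I_3} := [ffun=> ord_max].

Definition gamma : nat := #|[arg min_(D < [set: G] | dominating D) #|D| ]|.

Definition rho : nat := \max_(A : {set G} | packing A) #|A|.

Definition gammaR : nat := weight [arg min_(f < const2 | RDF f) weight f].

(* A TRDF exists exactly when G has no isolated vertex; otherwise the value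
   of [gammatR] is meaningless. *)
Definition gammatR : nat := weight [arg min_(f < const2 | TRDF f) weight f].

Lemma dominatingT : dominating [set: G].
Proof. by apply/forallP => v; rewrite in_setT. Qed.

Lemma packing0 : packing set0.
Proof. by apply/forall_inP => x; rewrite inE. Qed.

Lemma RDF_const2 : RDF const2.
Proof. by apply/forall_inP => v; rewrite inE ffunE. Qed.

Lemma TRDF_const2 : no_isolated G -> TRDF const2.
Proof.
move=> /forallP nG; rewrite /TRDF RDF_const2; apply/forallP => v.
have /set0Pn[w] := nG (val v); rewrite inE => vw.
have wS : w \in V_ const2 1 :|: V_ const2 2 by rewrite !inE ffunE.
by apply/set0Pn; exists (Sub w wS); rewrite inE.
Qed.

Lemma gammaP :
  (exists2 D, dominating D & gamma = #|D|) /\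
  (forall D, dominating D -> gamma <= #|D|).
Proof.
by rewrite /gamma; case: arg_minnP => [|D dD Dm]; [exact: dominatingT|];
  split=> //; exists D.
Qed.

Lemma rhoP :
  (exists2 A, packing A & rho = #|A|) /\
  (forall A, packing A -> #|A| <= rho).
Proof.
split=> [|A pA]; last exact: (leq_bigmax_cond (F := fun A : {set G} => #|A|)).
have [|A pA eA] := @eq_bigmax_cond _ (mem packing) (fun A : {set G} => #|A|).
  by apply/card_gt0P; exists set0; exact: packing0.
by exists A => //; rewrite -eA; apply: eq_bigl.
Qed.

Lemma gammaRP :
  (exists2 f, RDF f & gammaR = weight f) /\
  (forall f, RDF f -> gammaR <= weight f).
Proof.
by rewrite /gammaR; case: arg_minnP => [|f Rf fm]; [exact: RDF_const2|];
  split=> //; exists f.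
Qed.

Lemma gammatRP : no_isolated G ->
  (exists2 f, TRDF f & gammatR = weight f) /\
  (forall f, TRDF f -> gammatR <= weight f).
Proof.
move=> nG; rewrite /gammatR; case: arg_minnP => [|f Tf fm].
  exact: TRDF_const2.
by split=> //; exists f.
Qed.
End Domination.

(* Main.v *)
Require Import Defs.
From mathcomp Require Import all_boot.

(** Lower bound: if [A] is a packing of [G] and [f] is an RDF of [G x H], then
    for each [x] in [A] the fibre sums [v |-> sum of f (u, v) over u in N[x]],
    truncated at 2, form an RDF of [H], and the sets [N[x] x H] are disjoint.

    Upper bound: let [D] dominate [G], let [D'] be [D] together with one
    neighbour of each of its vertices, and let [g] be a TRDF of [H] with level
    sets [V1] and [V2].  Then [D' x V2] together with [D x V1] dominates
    [G x H] and has at most [2 |D| |V2| + |D| |V1| = |D| w(g)] elements, and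
    doubling the indicator function of a dominating set gives an RDF. *)

Lemma weight_sum (G : sgraph) (f : {ffun G -> 'I_3}) :
  weight f = \sum_(v : G) f v.
Proof.
rewrite /weight -!sum1_card big_distrr /=.
rewrite big_mkcond [X in _ + X]big_mkcond -big_split /=.
by apply: eq_bigr => v _; rewrite !inE; case: (f v) => [[|[|[|]]]].
Qed.

(* Values above 2 are allowed, so that fibre sums can be used without first
   truncating them. *)
Lemma gammaR_le_sum (G : sgraph) (F : G -> nat) :
    (forall v, F v = 0 -> exists2 w, adj v w & 1 < F w) ->
  gammaR G <= \sum_(v : G) F v.
Proof.
move=> hF; pose f : {ffun G -> 'I_3} := [ffun v => inord (minn (F v) 2)].
have fE v : f v = minn (F v) 2 :> nat.
  by rewrite ffunE inordK // ltnS geq_minr.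
have Rf : RDF f.
  apply/forall_inP => v; rewrite inE fE => Fv.
  have [|w vw Fw] := hF v; first by case: (F v) Fv => [|[]].
  by apply/exists_inP; exists w; rewrite // inE fE (minn_idPr Fw).
apply: (leq_trans ((gammaRP G).2 f Rf)); rewrite weight_sum.
by apply: leq_sum => v _; rewrite fE geq_minl.
Qed.

Lemma gammaR_le_dominating {G : sgraph} {S : {set G}} :
  dominating S -> gammaR G <= 2 * #|S|.
Proof.
move=> /forallP domS; rewrite -sum1_card big_distrr [X in _ <= X]big_mkcond /=.
apply: gammaR_le_sum => v; have := domS v; case: (v \in S) => //=.
by move=> /exists_inP[w wS vw] _; exists w => //; rewrite wS.
Qed.

Lemma RDF_adj {G : sgraph} {f : {ffun G -> 'I_3}} {v : G} :
  RDF f -> f v = 0 :> nat -> exists2 w, adj v w & f w = 2 :> nat.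
Proof.
move=> /forall_inP Rf fv; have := Rf v; rewrite inE fv => /(_ isT).
by case/exists_inP => w; rewrite inE => /eqP fw vw; exists w.
Qed.

(** A vertex of value 0 has a neighbour of value 2; any other has one in the induced subgraph, where
    no vertex is isolated. *)
Lemma TRDF_adj {G : sgraph} {g : {ffun G -> 'I_3}} (v : G) :
  TRDF g -> exists2 w, adj v w & w \in V_ g 1 :|: V_ g 2.
Proof.
case/andP => Rg /forallP tg; have [gv|gv] := eqVneq (g v : nat) 0.
  have [w vw gw] := RDF_adj Rg gv.
  by exists w; rewrite // !inE gw.
have vS : v \in V_ g 1 :|: V_ g 2.
  by rewrite !inE; case: (g v) gv => [[|[|[|]]]].
have /set0Pn[w] := tg (Sub v vS); rewrite inE => vw.
by exists (val w); [exact: vw | exact: valP].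
Qed.

Lemma no_isolatedP {G : sgraph} (v : G) : no_isolated G -> exists w, adj v w.
Proof. by move=> /forallP/(_ v)/set0Pn[w]; rewrite inE => vw; exists w. Qed.

Lemma packing_sum_le (G : sgraph) (A : {set G}) (F : G -> nat) :
  packing A -> \sum_(x in A) \sum_(u in cln x) F u <= \sum_(u : G) F u.
Proof.
move=> /forall_inP pA.
rewrite (exchange_big_dep xpredT) //=; apply: leq_sum => u _.
rewrite sum_nat_const -[X in _ <= X]mul1n leq_mul2r; apply/orP; right.
(* Closed neighbourhoods of distinct members of [A] are disjoint, so [F u] is counted at most
   once. *)
apply/card_le1_eqP => x y /andP[xA ux] /andP[yA uy].
have /forall_inP/(_ y yA) := pA x xA.
by case: eqVneq => //= _ /eqP/setP/(_ u); rewrite in_setI ux uy in_set0.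
Qed.

Lemma rho_gammaR_le (G H : sgraph) :
  rho G * gammaR H <= gammaR (dprod_graph G H).
Proof.
have [[A pA ->] _] := rhoP G.
have [[f Rf ->] _] := gammaRP (dprod_graph G H).
have fibre x : gammaR H <= \sum_(v : H) \sum_(u in cln x) f (u, v).
  apply: gammaR_le_sum => v /eqP; rewrite sum_nat_eq0 => /forall_inP f0.
  (* As [x] lies in [cln x], a zero fibre sum forces [f (x, v) = 0]. The resulting [u] is adjacent
     to [x], so the fibre sum at [w] is at least 2. *)
  have /(RDF_adj Rf)[[u w] /andP[/= xu vw] fuw] : f (x, v) = 0 :> nat.
    by apply/eqP/f0; rewrite setU11.
  exists w => //; rewrite (bigD1 u) /=; first by rewrite fuw.
  by rewrite !inE xu orbT.
rewrite -sum_nat_const weight_sum.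
apply: (leq_trans (leq_sum _ (fun x _ => fibre x))).
under eq_bigr => x _ do rewrite exchange_big /=.
apply: (leq_trans (packing_sum_le _ _ _ pA)).
by rewrite pair_bigA; apply: eq_leq; apply: eq_bigr => -[].
Qed.

Lemma gammaR_dprod_le (G H : sgraph) :
  no_isolated G -> no_isolated H ->
  gammaR (dprod_graph G H) <= 2 * gamma G * gammatR H.
Proof.
move=> hG hH; have [[D domD ->] _] := gammaP G.
have [[g tg ->] _] := gammatRP hH.
pose nb u := xchoose (no_isolatedP u hG).
have nbP u : adj u (nb u) by exact: xchooseP.
pose D' := D :|: nb @: D.
pose S : {set dprod_graph G H} := setX D' (V_ g 2) :|: setX D (V_ g 1).
have totD' u : exists2 u', adj u u' & u' \in D'.
  have /orP[uD|/exists_inP[u' u'D uu']] := forallP domD u.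
    by exists (nb u) => //; rewrite inE imset_f ?orbT.
  by exists u' => //; rewrite inE u'D.
have domS : dominating S.
  apply/forallP => -[u v].
  (* If [u] has a neighbour [u'] in [D], then [(u', w)] lies in [S] whether [w] has value 1 or 2,
     because [D] is contained in [D']. *)
  have /orP[uD|/exists_inP[u' u'D uu']] := forallP domD u; last first.
    have [w vw wg] := TRDF_adj v tg.
    apply/orP; right; apply/exists_inP; exists (u', w); last exact/andP.
    by move: wg; rewrite !inE /= u'D /= orbC.
  (* For [u] in [D], either [(u, v)] is itself in [S], or [g v = 0] and a neighbour is found in [D']
     times [V_ g 2]. *)
  have [gv|gv] := eqVneq (g v : nat) 0; last first.
    by rewrite !inE /= uD /=; case: (g v) gv => [[|[|[|]]]].
  have [w vw gw] := RDF_adj (andP tg).1 gv; have [u' uu' u'D] := totD' u.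
  apply/orP; right; apply/exists_inP; exists (u', w); last exact/andP.
  by rewrite inE in_setX u'D inE gw.
apply: (leq_trans (gammaR_le_dominating domS)).
rewrite -mulnA leq_mul2l /=; apply: (leq_trans (leq_card_setU _ _)).
rewrite !cardsX /weight mulnDr addnC leq_add2l mulnA (mulnC _ 2) leq_mul2r.
apply/orP; right; apply: (leq_trans (leq_card_setU _ _)).
by rewrite mul2n -addnn leq_add2l leq_imset_card.
Qed.

(** Swapping coordinates carries an RDF of one product to an RDF of the other with the same weight.
    This yields the bounds with [G] and [H] exchanged. *)
Lemma gammaR_dprod_swap (G H : sgraph) :
  gammaR (dprod_graph G H) <= gammaR (dprod_graph H G).
Proof.
have [[f Rf ->] _] := gammaRP (dprod_graph H G).
have swapK (S T : Type) : cancel (@swap_pair S T) swap_pair by case.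
rewrite weight_sum (reindex (@swap_pair G H)) /=; last first.
  by exists swap_pair => p _; rewrite swapK.
apply: gammaR_le_sum => -[u v] /(RDF_adj Rf)[[w z] /andP[/= vw uz] fw].
by exists (z, w); [exact/andP | rewrite /swap_pair /= fw].
Qed.

Theorem theorem2p2 (G H : sgraph) (hG : no_isolated G) (hH : no_isolated H) :
  maxn (rho G * gammaR H) (rho H * gammaR G)
    <= gammaR (dprod_graph G H)
    <= minn (2 * gamma G * gammatR H) (2 * gamma H * gammatR G).
Proof.
rewrite geq_max leq_min rho_gammaR_le gammaR_dprod_le //=.
rewrite (leq_trans (rho_gammaR_le H G)) ?gammaR_dprod_swap //=.
by rewrite (leq_trans (gammaR_dprod_swap G H)) ?gammaR_dprod_le.
Qed.
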